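(* Let $G$ be a connected finite simple graph such that $\nu(G')=\eta(G')$ for every induced subgraph $G'$ of $G$. Then $G$ is bipartite, or complete multipartite, or a blowup of a cycle.
   Context: For an $n$-vertex digraph $D$ (no loops), a permutation of $D$ is a bijection $\sigma:V(D)\to[n]$; an arc $u\to v$ is a descent of $\sigma$ if $\sigma(u)>\sigma(v)$, and $\mathrm{des}_D(\sigma)$ is the number of descents. $A_D(t)=\sum_{\sigma}t^{\mathrm{des}_D(\sigma)}$ over all such bijections. For a graph $G$, $\nu(G):=|A_D(-1)|$ where $D$ is any orientation of $G$ (independent of the orientation). An ordering $(\pi_1,\dots,\pi_n)$ of $V(G)$ is an even sequence if $G[\{\pi_1,\dots,\pi_i\}]$ has an even number of edges for every $1\le i\le n$; $\eta(G)$ is the number of even sequences. Complete multipartite: vertex set partitioned into $V_1,\dots,V_r$ with $u,v$ adjacent iff in different parts. Blowup of a cycle: vertex set partitioned into $V_1,\dots,V_r$ with $u,v$ adjacent iff $u\in V_i$, $v\in V_{i+1}$ for some $i$ (indices mod $r$). *)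

(* Defs.v *)
From mathcomp Require Import all_boot all_order all_algebra.

Set Implicit Arguments.
Unset Strict Implicit.
Unset Printing Implicit Defensive.

Import GRing.Theory Num.Theory.

(** A finite simple graph is a symmetric irreflexive [e : rel T] on a finType
    [T]; a digraph is a relation [d : rel T], with [d u v] meaning u -> v. *)

Section Eulerian.

Variable T : finType.
Implicit Types (d e : rel T) (s : {ffun T -> 'I_#|T|}).

(** Labels are numbered from 0, so [n] is encoded as {0, ..., n-1}. *)
Definition labelings : {set {ffun T -> 'I_#|T|}} :=
  [set s : {ffun T -> 'I_#|T|} | injectiveb s].

Lemma labelingsP s : reflect (bijective s) (s \in labelings).
Proof.
rewrite inE; apply: (iffP (injectiveP s)) => [sI | /bij_inj //].
by apply: inj_card_bij; rewrite ?card_ord.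
Qed.

Definition descents d s : {set T * T} :=
  [set a | d a.1 a.2 && (s a.2 < s a.1)].

Definition des d s : nat := #|descents d s|.

Definition eulerian d : {poly int} := (\sum_(s in labelings) 'X^(des d s))%R.

Definition orientation e d : Prop :=
  (forall u v, e u v = d u v || d v u) /\
  (forall u v, ~~ (d u v && d v u)).

Definition std_orientation e : rel T :=
  [rel u v | e u v && (enum_rank u < enum_rank v)].

(** [nu] does not depend on the orientation: see [nuE]. *)
Definition nu e : nat := `|(eulerian (std_orientation e)).[-1]%R|%N.

Lemma std_orientationP e :
  symmetric e -> irreflexive e -> orientation e (std_orientation e).
Proof.
move=> eS eI; split=> u v /=; last first.
  by apply/negP => /andP[/andP[_ h1] /andP[_ h2]]; move: (ltn_trans h1 h2); rewrite ltnn.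
rewrite /std_orientation /= (eS v u) -andb_orr -neq_ltn.
have [E|_] := eqVneq (enum_rank u) (enum_rank v).
  by rewrite (enum_rank_inj E) eI.
case: eqP => [/val_inj E|]; last by rewrite andbT.
by rewrite (enum_rank_inj E) eI.
Qed.

Lemma odd_des_orientation e d d' s :
  orientation e d -> orientation e d' -> s \in labelings ->
  odd (des d' s) = odd (des d s) (+) odd #|[set a | d a.1 a.2 && ~~ d' a.1 a.2]|.
Proof.
move=> [dE dA] [d'E d'A]; rewrite inE => /injectiveP sI.
pose R := [set a : T * T | d' a.1 a.2].
pose R0 := [set a : T * T | d a.1 a.2].
rewrite /des -(cardsID R (descents d s)) -(cardsID R0 (descents d' s)).
have -> : descents d' s :&: R0 = descents d s :&: R.
  by apply/setP=> a; rewrite !inE; do !case: (_ a.1 a.2); rewrite ?andbF ?andbT.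
pose sw (a : T * T) := (a.2, a.1).
have swK : involutive sw by case.
rewrite -(card_imset (descents d' s :\: R0) (inv_inj swK)).
rewrite -(cardsID (descents d s) [set a | d a.1 a.2 && ~~ d' a.1 a.2]).
have -> : [set a | d a.1 a.2 && ~~ d' a.1 a.2] :&: descents d s = descents d s :\: R.
  by apply/setP=> a; rewrite !inE; case: (d _ _); case: (d' _ _); rewrite ?andbF ?andbT.
have -> : [set a | d a.1 a.2 && ~~ d' a.1 a.2] :\: descents d s
   = sw @: (descents d' s :\: R0).
  apply/setP=> -[u v]; rewrite (can2_imset_pre _ swK swK) !inE /=.
  move: (dE u v) (d'E u v) (dA u v) (d'A u v) => ->.
  case duv: (d u v); case dvu: (d v u); case: (d' u v); case d'vu: (d' v u) => //= _ _ _; rewrite ?andbF //.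
  rewrite andbT -leqNgt leq_eqVlt; case: eqP => //= /val_inj /sI E.
  by subst v; rewrite duv in dvu.
by rewrite !oddD -addbA addKb.
Qed.

Lemma nuE e d : symmetric e -> irreflexive e -> orientation e d ->
  nu e = `|(eulerian d).[-1]%R|%N.
Proof.
move=> eS eI od; have od0 := std_orientationP eS eI.
rewrite /nu /eulerian !horner_sum.
rewrite (eq_bigr (fun s =>
  (-1) ^+ #|[set a | d a.1 a.2 && ~~ std_orientation e a.1 a.2]| * 'X^(des d s).[-1])%R).
  by rewrite -mulr_sumr abszM abszX exp1n mul1n.
move=> s sL; rewrite !hornerXn -exprD -[LHS]signr_odd -[RHS]signr_odd.
by rewrite (odd_des_orientation od od0 sL) oddD addbC.
Qed.

End Eulerian.

Section Graphs.

Variable T : finType.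
Implicit Types (e : rel T) (A : {set T}).

Definition induced_edges e A : {set {set T}} :=
  [set E : {set T} | (E \subset A) &&
     [exists u, exists v, e u v && (E == [set u; v])]].

Definition even_sequence e (p : #|T|.-tuple T) : bool :=
  uniq p &&
  [forall i : 'I_#|T|, ~~ odd #|induced_edges e [set x in take i.+1 p]|].

Definition eta e : nat := #|[set p : #|T|.-tuple T | even_sequence e p]|.

Definition induced e A : rel {x : T | x \in A} := [rel u v | e (val u) (val v)].

Definition connected_graph e : Prop := forall u v, connect e u v.

Definition bipartite e : Prop :=
  exists A, forall u v, e u v -> (u \in A) != (v \in A).

Definition vertex_partition (r : nat) (V : 'I_r -> {set T}) : Prop :=
  (forall i, V i != set0) /\ (forall u, exists! i, u \in V i).

Definition complete_multipartite e : Prop :=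
  exists (r : nat) (V : 'I_r -> {set T}), vertex_partition V /\
    forall u v, e u v <-> exists i j, [/\ i != j, u \in V i & v \in V j].

(** [ordS] is the cyclic successor on 'I_r. *)
Definition cycle_blowup e : Prop :=
  exists (r : nat) (V : 'I_r -> {set T}), [/\ 3 <= r, vertex_partition V &
    forall u v, e u v <-> exists i,
      (u \in V i /\ v \in V (ordS i)) \/ (v \in V i /\ u \in V (ordS i))].

End Graphs.

Arguments induced [T] e A.

(* Main.v *)
Require Import Defs.
From mathcomp Require Import all_boot all_order all_algebra.
From mathcomp Require Import zify ring.

(** Reversing the longest prefix that induces an odd number of edges is a
    sign-reversing involution on the labelings that are not even sequences, so
    [A_D(-1)] is the signed count of the even sequences.  Hence [nu = eta] holds
    exactly when any two even sequences disagree on an even number of edges.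

    An odd cycle with a pendant vertex has two even sequences that order the ends
    of every cycle edge differently and agree on the pendant edge, so it cannot
    be an induced subgraph.  If [c] is a shortest odd cycle, a vertex adjacent to
    [c i] is then also adjacent to [c (i + 2)] or [c (i - 2)], i.e. it is a twin
    of a cycle vertex; replacing that cycle vertex by its twin gives another
    shortest odd cycle, and by connectedness every vertex is a twin.  For length 3
    this makes non-adjacency transitive, for length at least 5 the twin classes
    form a blowup of the cycle. *)

Set Implicit Arguments.
Unset Strict Implicit.
Unset Printing Implicit Defensive.

Import GRing.Theory.

(** * Even sequences and the Eulerian polynomial at -1 *)

Section EvenLabelings.

Variables (T : finType) (e : rel T).
Hypotheses (eS : symmetric e) (eI : irreflexive e).
Implicit Types (d : rel T) (s : {ffun T -> 'I_#|T|}) (A : {set T}).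

Lemma orientation_neq d u v : orientation e d -> d u v -> u != v.
Proof.
by case=> _ dA duv; apply: contraTneq duv => <-; have := dA u u; rewrite andbb.
Qed.

Lemma card_induced_edges d A : orientation e d ->
  #|induced_edges e A| = #|[set a | [&& d a.1 a.2, a.1 \in A & a.2 \in A]]|.
Proof.
move=> od; have [dE dA] := od.
set B := [set a | _]; have <- : [set [set a.1; a.2] | a in B] = induced_edges e A.
  apply/setP=> E; rewrite inE; apply/imsetP/andP => [[[u v]]|[EA]].
    rewrite inE /= => /and3P[duv uA vA] ->; split.
      by rewrite subUset !sub1set uA.
    by apply/existsP; exists u; apply/existsP; exists v; rewrite dE duv eqxx.
  case/existsP=> u /existsP[v /andP[euv /eqP EE]]; subst E.
  move: EA; rewrite subUset !sub1set => /andP[uA vA].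
  move: euv; rewrite dE => /orP[duv|dvu].
    by exists (u, v); rewrite ?inE //= duv uA.
  by exists (v, u); rewrite ?inE /= ?dvu ?uA ?vA // setUC.
rewrite card_in_imset // => -[u v] [u' v']; rewrite !inE /=.
case/and3P=> duv _ _ /and3P[duv' _ _] /setP E.
have := dA u v; rewrite duv /= => ndvu.
move: (E u) (E v); rewrite !inE !eqxx /= orbT => /esym h1 /esym h2.
case/orP: h1 => /eqP h1; case/orP: h2 => /eqP h2; subst.
- by have := orientation_neq od duv; rewrite eqxx.
- by [].
- by rewrite duv' in ndvu.
- by have := orientation_neq od duv; rewrite eqxx.
Qed.

Definition prefix_set s (i : nat) : {set T} := [set x | s x <= i].

Definition odd_prefix s i := odd #|induced_edges e (prefix_set s i)|.

(** Even sequences seen as position functions; labels start at 0, so index [i] stands for the prefix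
    of [i.+1] vertices. *)
Definition even_labelings :=
  [set s in labelings T | [forall i : 'I_#|T|, ~~ odd_prefix s i]].

Lemma card_even_labelings : #|even_labelings| <= eta e.
Proof.
(* [lab] reads off positions; [enum_rank x] is a default for sequences that miss [x]. *)
pose lab (p : #|T|.-tuple T) : {ffun T -> 'I_#|T|} :=
  [ffun x => insubd (enum_rank x) (index x p)].
rewrite /eta; set E := [set p | _]; apply: leq_trans (leq_imset_card lab E).
apply: subset_leq_card; apply/subsetP => s; rewrite inE => /andP[/labelingsP[g sK gK]].
move/forallP=> sE; apply/imsetP.
have szp : size (map g (enum 'I_#|T|)) == #|T| by rewrite size_map size_enum_ord.
pose p := Tuple szp.
have sp x : index x p = s x.
  by rewrite /= -{1}(sK x) index_map ?index_enum_ord //; apply: can_inj gK.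
exists p; last first.
  by apply/ffunP=> x; apply/val_inj; rewrite ffunE sp valKd.
rewrite inE /even_sequence.
apply/andP; split; first by rewrite map_inj_uniq ?enum_uniq //; apply: can_inj gK.
apply/forallP=> i; have := sE i; rewrite /odd_prefix.
congr (~~ odd #|induced_edges e _|); apply/setP => x; rewrite !inE.
by rewrite in_take_leq ?size_tuple // sp.
Qed.


Definition reverse_prefix (j : 'I_#|T|) (k : 'I_#|T|) : 'I_#|T| :=
  insubd k (if k <= j then j - k else k).

Lemma val_reverse_prefix j k :
  reverse_prefix j k = (if k <= j then j - k else k) :> nat.
Proof.
rewrite /reverse_prefix; case: ifP => _; last by rewrite valKd.
by rewrite insubdK //; apply: leq_ltn_trans (leq_subr _ _) (ltn_ord j).
Qed.

Lemma reverse_prefixK j : involutive (reverse_prefix j).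
Proof.
move=> k; apply/val_inj; rewrite /= !val_reverse_prefix.
by have [kj|kj] := leqP k j; rewrite ?leq_subr ?subKn // leqNgt kj.
Qed.

Definition reverse_labels j s : {ffun T -> 'I_#|T|} :=
  [ffun x => reverse_prefix j (s x)].

Lemma reverse_labelsK j : involutive (reverse_labels j).
Proof. by move=> s; apply/ffunP=> x; rewrite !ffunE reverse_prefixK. Qed.

Lemma reverse_labels_labelings j s :
  (reverse_labels j s \in labelings T) = (s \in labelings T).
Proof.
have imp s' : s' \in labelings T -> reverse_labels j s' \in labelings T.
  rewrite !inE => /injectiveP sI; apply/injectiveP=> x y.
  by rewrite !ffunE => /(inv_inj (reverse_prefixK j)) /sI.
by apply/idP/idP => [/imp|/imp //]; rewrite reverse_labelsK.
Qed.

(** Reversal permutes the labels up to [j] among themselves, so prefixes at least that long keep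
    their vertex set. *)
Lemma odd_prefix_reverse (j : 'I_#|T|) s i : j <= i ->
  odd_prefix (reverse_labels j s) i = odd_prefix s i.
Proof.
move=> ji; congr (odd #|induced_edges e _|); apply/setP => x.
by rewrite !inE ffunE val_reverse_prefix; case: ifP; lia.
Qed.

(** Exactly the arcs with both ends in the prefix change direction. On this set [B] of arcs the
    descents are complemented, which changes their number by [#|B|] modulo 2. *)
Lemma odd_des_reverse d j s : orientation e d -> s \in labelings T ->
  odd (des d (reverse_labels j s)) = odd (des d s) (+) odd_prefix s j.
Proof.
move=> od; rewrite inE => /injectiveP sI; rewrite /odd_prefix (card_induced_edges _ od).
set B := [set a | _]; set D := descents d s; set D' := descents d (reverse_labels j s).
rewrite /des -/D -/D' -(cardsID B D') -(cardsID B D) -(cardsID D B).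
have -> : D' :\: B = D :\: B.
  apply/setP=> -[u v]; rewrite !inE !ffunE /= !val_reverse_prefix.
  by case: (d u v) => //=; case: (leqP (s u) j); case: (leqP (s v) j) => /=; lia.
have -> : D' :&: B = B :\: D.
  apply/setP=> -[u v]; rewrite !inE !ffunE /= !val_reverse_prefix.
  case duv: (d u v) => //=.
  suff : (s u : nat) <> s v by case: (leqP (s u) j); case: (leqP (s v) j) => /=; lia.
  move=> /val_inj /sI uv; by have := orientation_neq od duv; rewrite uv eqxx.
rewrite (setIC D B) !oddD.
by case: (odd #|B :\: D|); case: (odd #|D :\: B|); case: odd.
Qed.

(* Reversing a prefix that induces an odd number of edges flips the sign and
   keeps all longer prefixes, so the labelings whose longest odd prefix has a
   given length cancel out. *)
Lemma eulerianN1 d : orientation e d ->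
  (eulerian d).[-1]%R = (\sum_(s in even_labelings) (-1) ^+ des d s)%R.
Proof.
move=> od; rewrite /eulerian horner_sum.
under eq_bigr do rewrite hornerXn.
pose P j s := [forall k : 'I_#|T|, (j <= k) ==> ~~ odd_prefix s k].
have step (j : 'I_#|T|) :
    (\sum_(s in labelings T | P j.+1 s) (-1) ^+ des d s =
     \sum_(s in labelings T | P j s) (-1) ^+ des d s :> int)%R.
  rewrite (bigID (fun s => odd_prefix s j)) /= [X in (X + _)%R](_ : _ = 0%R) ?add0r.
    apply: eq_bigl => s; rewrite -andbA; congr (_ && _).
    apply/andP/forallP => [[/forallP h sj] k|h].
      apply/implyP; rewrite leq_eqVlt => /orP[/eqP/val_inj <- //|jk].
      by have := h k; rewrite jk.
    split; last by have := h j; rewrite leqnn.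
    by apply/forallP=> k; apply/implyP => /ltnW jk; have := h k; rewrite jk.
  set S := (\sum_(_ | _) _)%R; suff : S = (- S)%R by lia.
  rewrite {1}/S (reindex_inj (inv_inj (reverse_labelsK j))) /S -sumrN.
  rewrite /= (eq_bigl (fun s => [&& s \in labelings T, P j.+1 s & odd_prefix s j])).
    rewrite [RHS](eq_bigl (fun s => [&& s \in labelings T, P j.+1 s & odd_prefix s j])).
      apply: eq_bigr => s /and3P[sL _ sj].
      rewrite -signr_odd odd_des_reverse // sj addbT signrN signr_odd //.
    by move=> s; rewrite /= andbA.
  move=> s; rewrite reverse_labels_labelings odd_prefix_reverse // -andbA.
  congr [&& _, _ & _]; apply: eq_forallb => k.
  by case: ltnP => //= /ltnW jk; rewrite odd_prefix_reverse.
(* [P #|T|] holds vacuously and [P 0] singles out the even labelings; [step] leads from one to the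
   other. *)
have all_P j : j <= #|T| ->
    (\sum_(s in labelings T) (-1) ^+ des d s =
     \sum_(s in labelings T | P (#|T| - j)%N s) (-1) ^+ des d s :> int)%R.
  elim: j => [_|j IHj jT].
    rewrite subn0; apply: eq_bigl => s; rewrite [P _ _](_ : _ = true) ?andbT //.
    by apply/forallP => k; rewrite leqNgt ltn_ord.
  have jT' : #|T| - j.+1 < #|T| by rewrite ltn_subrL; apply: leq_trans jT.
  by rewrite (IHj (ltnW jT)) -(step (Ordinal jT')) /= subnSK.
rewrite (all_P #|T| (leqnn _)) subnn; apply: eq_bigl => s.
by rewrite [RHS]in_set.
Qed.

(** If [a] and [b] count the even labelings of each descent parity, then [nu e] is the absolute
    value of [a - b] while [eta e] is at least [a + b]; equality leaves no room for both to be
    positive. *)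
Lemma odd_des_even_labelings d s1 s2 : nu e = eta e -> orientation e d ->
  s1 \in even_labelings -> s2 \in even_labelings ->
  odd (des d s1) = odd (des d s2).
Proof.
move=> nueta od s1E s2E.
pose X b := [set s in even_labelings | odd (des d s) == b].
have /eqP : nu e = absz (Posz #|X false| - Posz #|X true|)%R.
  rewrite (nuE eS eI od) eulerianN1 //; congr absz.
  rewrite (bigID (fun s => odd (des d s))) /= addrC; congr (_ + _)%R.
    rewrite (eq_bigr (fun=> 1%R)); last first.
      by move=> s /andP[_ /negbTE os]; rewrite -signr_odd os.
    rewrite sumr_const natz; congr (Posz _); apply: eq_card => s.
    by rewrite unfold_in /= [RHS]in_set eqbF_neg.
  rewrite (eq_bigr (fun=> (-1)%R)); last first.
    by move=> s /andP[_ os]; rewrite -signr_odd os.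
  rewrite sumr_const mulNrn natz; congr (- Posz _)%R; apply: eq_card => s.
  by rewrite unfold_in /= [RHS]in_set eqb_id.
have := card_even_labelings.
have -> : #|even_labelings| = #|X false| + #|X true|.
  rewrite -cardsUI [X in _ = _ + X]eq_card0 ?addn0.
    by apply: eq_card => s; rewrite !inE; case: (odd _); rewrite ?andbF ?andbT ?orbF.
  by move=> s; rewrite !inE; case: (odd _); rewrite ?andbF.
have pos s : s \in even_labelings -> 0 < #|X (odd (des d s))|.
  by move=> sE; apply/card_gt0P; exists s; rewrite inE sE eqxx.
move: (pos _ s1E) (pos _ s2E); rewrite nueta.
by case: (odd _); case: (odd _) => //; lia.
Qed.

Lemma labeling_of_injection (h : T -> nat) : injective h ->
  exists2 s, s \in labelings T & forall x y, (s x < s y) = (h x < h y).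
Proof.
move=> hI; pose below x := [set y | h y < h x].
have belowP x : #|below x| < #|T|.
  rewrite -cardsT; apply/proper_card/properP; split; first exact: subsetT.
  by exists x; rewrite !inE ?ltnn.
pose s : {ffun T -> 'I_#|T|} := [ffun x => Ordinal (belowP x)].
have mono x y : h x < h y -> s x < s y.
  move=> hxy; rewrite !ffunE; apply/proper_card/properP; split.
    by apply/subsetP=> z; rewrite !inE => /ltn_trans; apply.
  by exists x; rewrite !inE ?ltnn.
exists s => [|x y].
  rewrite inE; apply/injectiveP=> x y sxy; apply: hI.
  by case: (ltngtP (h x) (h y)) => // /mono; rewrite sxy ltnn.
case: (ltngtP (h x) (h y)) => [/mono //|/mono|/hI ->]; last by rewrite ltnn.
by case: ltngtP.
Qed.

(* A rank function that separates adjacent vertices stands for the acyclic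
   orientation it induces; all in-degrees even means that any compatible
   ordering is an even sequence. *)
Definition even_rank (g : T -> nat) :=
  (forall u v, e u v -> g u != g v) /\
  (forall v, ~~ odd #|[set u | e u v && (g u < g v)]|).

(** Group the edges of a prefix by their later end [v]. All lower neighbors of [v] precede it, so
    [v] contributes its whole in-degree, which is even. *)
Lemma even_rank_labeling g : even_rank g ->
  exists2 s, s \in even_labelings & forall u v, e u v -> (s u < s v) = (g u < g v).
Proof.
(* Lexicographic order: first [g], with ties broken by [enum_rank]. *)
case=> gP gE; pose h x := g x * #|T| + enum_rank x.
have hI : injective h.
  move=> x y /(congr1 (modn^~ #|T|)); rewrite !modnMDl !modn_small ?ltn_ord //.
  by move/val_inj/enum_rank_inj.
have [s sL sh] := labeling_of_injection hI.
have sg u v : e u v -> (s u < s v) = (g u < g v).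
  have lex x y : g x < g y -> h x < h y.
    move=> gxy; apply: (@leq_trans ((g x).+1 * #|T|)).
      by rewrite /h mulSn [X in _ < X]addnC ltn_add2l ltn_ord.
    by apply: leq_trans (leq_addr _ _); rewrite leq_mul2r gxy orbT.
  move=> euv; rewrite sh; have := gP _ _ euv.
  by case: (ltngtP (g u) (g v)) => // [/lex //|/lex]; case: ltngtP.
exists s => //; rewrite inE sL /=; apply/forallP=> i.
pose d : rel T := [rel u v | e u v && (s u < s v)].
have od : orientation e d.
  split=> u v; rewrite /d /=; last by apply/negP=> /andP[/andP[_ +] /andP[_ +]]; case: ltngtP.
  rewrite (eS v u); case euv: (e u v) => //=.
  by rewrite sg // sg 1?eS // orbC; have := gP _ _ euv; lia.
rewrite /odd_prefix (card_induced_edges _ od).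
rewrite -sum1_card (partition_big (fun a : T * T => a.2) predT) //=.
elim/big_ind: _ => // [m n|v _]; first by rewrite oddD => /negbTE -> .
have [vi|vi] := leqP (s v) i; last first.
  rewrite big_pred0 // => -[u w]; rewrite !inE /=.
  by case: eqP => [->|]; rewrite ?andbF // [s v <= i]leqNgt vi !andbF.
rewrite sum1_card; have /= := gE v.
rewrite -(@card_imset _ _ (fun u => (u, v))); last by move=> u u' [].
congr (~~ odd _); apply: eq_card => -[u w].
apply/imsetP/idP => [[u' + [-> ->]]|].
  rewrite inE => /andP[eu gu]; rewrite unfold_in /= !inE /d /= eu sg // gu vi eqxx andbT /=.
  rewrite (leq_trans _ vi) //; apply: ltnW; by rewrite sg.
rewrite unfold_in /= !inE /d /= => /andP[/andP[/andP[/= eu su] _] /eqP wv]; subst w.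
by exists u; rewrite // inE eu -sg.
Qed.

(** Orient every edge upwards for [g1]. The labeling of [g1] has no descents, and the descents of
    the labeling of [g2] are the disagreements. *)
Lemma even_rank_disagreements g1 g2 : nu e = eta e -> even_rank g1 -> even_rank g2 ->
  ~~ odd #|[set a | [&& e a.1 a.2, g1 a.1 < g1 a.2 & g2 a.2 < g2 a.1]]|.
Proof.
move=> nueta gE1 gE2.
have [s1 s1E s1g] := even_rank_labeling gE1.
have [s2 s2E s2g] := even_rank_labeling gE2.
pose d : rel T := [rel u v | e u v && (g1 u < g1 v)].
have od : orientation e d.
  split=> u v; rewrite /d /=; last by apply/negP=> /andP[/andP[_ +] /andP[_ +]]; case: ltngtP.
  by rewrite (eS v u); case euv: (e u v) => //=; have := gE1.1 _ _ euv; lia.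
have := odd_des_even_labelings nueta od s1E s2E; rewrite /des.
rewrite [descents d s1](_ : _ = set0) ?cards0.
  move=> /esym /negbT; congr (~~ odd _); apply: eq_card => -[u v].
  rewrite !inE /= -andbA; case euv: (e u v) => //=; by rewrite s2g // eS.
apply/setP=> -[u v]; rewrite !inE /d /=; case euv: (e u v) => //=.
by rewrite s1g 1?eS //; case: ltngtP.
Qed.

End EvenLabelings.

(** * Transfer to induced subgraphs given by an embedding *)

Section InducedSubgraphs.

Variables (T : finType) (e : rel T).
Hypotheses (eS : symmetric e) (eI : irreflexive e).
Hypothesis nu_eta : forall A : {set T}, nu (induced e A) = eta (induced e A).

Lemma embedded_even_rank_disagreements (S : finType) (f : S -> T) (g1 g2 : S -> nat) :
  injective f ->
  even_rank (relpre f e) g1 -> even_rank (relpre f e) g2 ->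
  ~~ odd #|[set a : S * S |
     [&& e (f a.1) (f a.2), g1 a.1 < g1 a.2 & g2 a.2 < g2 a.1]]|.
Proof.
move=> fI gE1 gE2; pose A := f @: setT.
have fA x : f x \in A by rewrite imset_f.
pose F x : {x | x \in A} := exist _ (f x) (fA x).
have Fbij : bijective F.
  apply: inj_card_bij => [x y [/fI //]|].
  by rewrite card_sig (eq_card (_ : _ =i A)) // card_imset // cardsT.
have [G FK GK] := Fbij.
have fG u : f (G u) = val u by rewrite -{2}(GK u).
have rank g : even_rank (relpre f e) g -> even_rank (induced e A) (g \o G).
  case=> gP gE; split=> [u v|v].
    by rewrite -(GK u) -(GK v) /= !FK; apply: gP.
  rewrite -(GK v); have := gE (G v); rewrite -(card_imset _ (bij_inj Fbij)).
  congr (~~ odd _); apply: eq_card => u; rewrite (can2_imset_pre _ FK GK) !inE /= FK.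
  by rewrite GK !fG.
have iS : symmetric (induced e A) by move=> u v; apply: eS.
have iI : irreflexive (induced e A) by move=> u; apply: eI.
have := even_rank_disagreements iS iI (nu_eta A) (rank _ gE1) (rank _ gE2).
pose F2 (a : S * S) := (F a.1, F a.2); pose G2 a := (G a.1, G a.2).
have FK2 : cancel F2 G2 by case=> u v; rewrite /G2 /= !FK.
have GK2 : cancel G2 F2 by case=> u v; rewrite /F2 /= !GK.
rewrite -[in X in _ -> X](card_imset _ (can_inj FK2)).
congr (~~ odd _); apply: eq_card => -[u v]; rewrite (can2_imset_pre _ FK2 GK2) !inE /=.
by rewrite !fG.
Qed.

End InducedSubgraphs.

(** * Walks and shortest odd cycles *)

Section Walks.

Variables (T : finType) (e : rel T).
Hypotheses (eS : symmetric e) (eI : irreflexive e).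

Fixpoint walk (k : nat) (u v : T) : bool :=
  if k is k'.+1 then [exists w, e u w && walk k' w v] else u == v.

Lemma walk1 u v : walk 1 u v = e u v.
Proof.
apply/existsP/idP => [[w /andP[euw /eqP <-]] //|euv].
by exists v; rewrite euv /=.
Qed.

Lemma walk_cat j k u v w : walk j u v -> walk k v w -> walk (j + k) u w.
Proof.
elim: j u => [u /eqP -> //|j IHj u /existsP[x /andP[eux xv]] vw].
by rewrite addSn; apply/existsP; exists x; rewrite eux; apply: IHj xv vw.
Qed.

Lemma walk_sym k u v : walk k u v -> walk k v u.
Proof.
elim: k u => [u|k IHk u /existsP[x /andP[eux /IHk vx]]]; first by rewrite /= eq_sym.
by rewrite -addn1; apply: walk_cat vx _; rewrite walk1 eS.
Qed.

Lemma walk_path u p : path e u p -> walk (size p) u (last u p).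
Proof.
elim: p u => //= x p IHp u /andP[eux /IHp xp].
by apply/existsP; exists x; rewrite eux.
Qed.

Lemma walk_fun k u v : walk k u v ->
  exists w : nat -> T, [/\ w 0 = u, w k = v & forall i, i < k -> e (w i) (w i.+1)].
Proof.
elim: k u => [u /eqP ->|k IHk u /existsP[x /andP[eux /IHk[w [w0 wk wS]]]]].
  by exists (fun=> v).
exists (fun i => if i is i'.+1 then w i' else u); split=> // -[_|i ik].
  by rewrite w0.
exact: wS.
Qed.

(** Color each vertex by the parity of a chosen walk from a root [r]. An edge inside a color class
    closes two such walks into an odd one. *)
Lemma bipartite_or_odd_walk : connected_graph e ->
  bipartite e \/ exists k, odd k && [exists u, walk k u u].
Proof.
move=> conn; case: (pickP (fun _ : T => true)) => [r _|T0]; last first.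
  by left; exists set0 => u; have := T0 u.
have reach v : exists k, walk k r v.
  by have /connectP[p rp ->] := conn r v; exists (size p); apply: walk_path.
pose dist v := xchoose (reach v).
have distP v : walk (dist v) r v := xchooseP (reach v).
case: (pickP (fun a : T * T => e a.1 a.2 && (odd (dist a.1) == odd (dist a.2)))).
  move=> [u v] /= /andP[euv /eqP uv]; right; exists (dist u + (1 + dist v)).
  apply/andP; split; first by rewrite !oddD uv; case: odd.
  apply/existsP; exists r; apply: walk_cat (distP u) _.
  by apply: walk_cat (walk_sym (distP v)); rewrite walk1.
move=> h; left; exists [set v | odd (dist v)] => u v euv.
by have := h (u, v); rewrite /= euv /= !inE => /negbT.
Qed.

(** The ordinals below [m.+3] form the ring of integers modulo [m.+3], so [i + 1] wraps around.
    Injectivity will follow from minimality, in [cycle_inj]. *)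
Definition edge_cycle m (c : 'I_m.+3 -> T) := forall i, e (c i) (c (i + 1)%R).

Definition odd_girth n := odd n /\ forall k u, odd k -> walk k u u -> n <= k.

Lemma val_ordD1 m (i : 'I_m.+3) : (i + 1)%R = (if i == m.+2 :> nat then 0 else i.+1) :> nat.
Proof.
rewrite /= addn1; case: eqP => [->|ni]; first by rewrite modnn.
by rewrite modn_small //; have := ltn_ord i; lia.
Qed.

Lemma shortest_odd_cycle k : odd k && [exists u, walk k u u] ->
  exists m (c : 'I_m.+3 -> T), odd_girth m.+3 /\ edge_cycle c.
Proof.
move=> ek; have ex : exists k, odd k && [exists u, walk k u u] by exists k.
case: (ex_minnP ex) => n /andP[on /existsP[u un]] nmin.
(* Length 1 would be a loop, so the minimal odd length is at least 3. *)
case: n on un nmin => [//|[|[//|m]]] om wu mmin; first by rewrite walk1 eI in wu.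
have [w [w0 wm wS]] := walk_fun wu.
exists m, (fun i => w i); split.
  by split=> // k' v ok' kv; apply: mmin; rewrite ok'; apply/existsP; exists v.
move=> i; rewrite val_ordD1; case: eqP => [im|_]; last exact: wS.
by rewrite w0 -wm im; apply: wS.
Qed.

Section ShortestOddCycle.

Variable m : nat.
Hypothesis girth : odd_girth m.+3.
Local Notation n := m.+3.
Implicit Types (c : 'I_n -> T) (i j : 'I_n).

Lemma natr_eq0_ord k : ((k%:R : 'I_n) == 0)%R = (n %| k).
Proof. by rewrite -(inj_eq val_inj) /= (@val_Zp_nat n). Qed.

Lemma natr_ord i : ((i : nat)%:R = i :> 'I_n)%R.
Proof. exact: natr_Zp. Qed.

Lemma natr_n0 : (n%:R = 0 :> 'I_n)%R.
Proof. by apply/eqP; rewrite natr_eq0_ord. Qed.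

Lemma two_neq0 : (2%:R != 0 :> 'I_n)%R.
Proof. by rewrite natr_eq0_ord gtnNdvd. Qed.

Lemma walk_cycle c i d : edge_cycle c -> walk d (c i) (c (i + d%:R)%R).
Proof.
move=> cE; elim: d => [|d IHd]; first by rewrite addr0 /=.
by rewrite -addn1 natrD addrA; apply: walk_cat IHd _; rewrite walk1.
Qed.

(** The walk closes up with either of the two arcs of the cycle, of lengths [d] and [n - d]. As [n]
    is odd, exactly one of these closed walks is odd, and its length is at least [n]. *)
Lemma chord_length c i d l : edge_cycle c -> d <= n -> walk l (c i) (c (i + d%:R)%R) ->
  if odd (d + l) then n <= d + l else d <= l.
Proof.
move=> cE dn wl; have [on gn] := girth.
case: ifP => odl.
  apply: (gn _ (c i)) => //; apply: walk_cat (walk_sym wl).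
  exact: walk_cycle.
have : walk (n - d + l) (c (i + d%:R)%R) (c (i + d%:R)%R).
  apply: walk_cat wl.
  have := walk_cycle (i + d%:R)%R (n - d) cE.
  by rewrite -addrA -natrD subnKC // natr_n0 addr0.
move=> /(gn _ _) h; suff : n <= n - d + l by lia.
by apply: h; lia.
Qed.

Lemma ord_offset i j : exists2 d, d < n & j = (i + d%:R)%R.
Proof. by exists (j - i)%R => //; rewrite natr_ord addrC subrK. Qed.

Lemma natr_opp k d : k + d = n -> (k%:R = - d%:R :> 'I_n)%R.
Proof. by move=> kd; apply/eqP; rewrite -addr_eq0 -natrD kd natr_n0. Qed.

(** This is [chord_length] for walks of length 0; lengths 1 and 2 give [cycle_adj] and
    [common_neighbor]. *)
Lemma cycle_inj c : edge_cycle c -> injective c.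
Proof.
move=> cE i j cij; have [d dn ji] := ord_offset i j; rewrite ji in cij *.
have /(chord_length cE (ltnW dn)) : walk 0 (c i) (c (i + d%:R)%R) by rewrite /= -cij.
rewrite addn0; case: ifP => _; first by lia.
by rewrite leqn0 => /eqP ->; rewrite addr0.
Qed.

Lemma cycle_adj c i j : edge_cycle c ->
  e (c i) (c j) = (j == i + 1)%R || (i == j + 1)%R.
Proof.
move=> cE; apply/idP/orP => [eij|[/eqP ->|/eqP ->] //]; last by rewrite eS.
have [d dn ji] := ord_offset i j; rewrite ji in eij *; have on := girth.1.
have /(chord_length cE (ltnW dn)) : walk 1 (c i) (c (i + d%:R)%R) by rewrite walk1.
case: ifP => od dl; [right | left].
  have -> : (d%:R = - 1%:R :> 'I_n)%R by apply: natr_opp; lia.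
  by rewrite subrK.
by have -> : d = 1 by lia.
Qed.

Lemma common_neighbor c i j v : edge_cycle c -> e v (c i) -> e v (c j) ->
  [\/ j = i, j = i + 2%:R | j = i - 2%:R]%R.
Proof.
move=> cE vi; have [d dn ->] := ord_offset i j => vj; have on := girth.1.
have /(chord_length cE (ltnW dn)) : walk 2 (c i) (c (i + d%:R)%R).
  by apply: (@walk_cat 1 1 _ v); rewrite walk1 // eS.
case: ifP => od dl.
  by constructor 3; congr (_ + _)%R; apply: natr_opp; lia.
have [->|->] : d = 0 \/ d = 2 by lia.
  by constructor 1; rewrite addr0.
by constructor 2.
Qed.

Definition twin c j v := e v (c (j - 1)%R) && e v (c (j + 1)%R).

Definition replace c j v : 'I_n -> T := fun i => if i == j then v else c i.

Lemma replace_cycle c j v : edge_cycle c -> twin c j v -> edge_cycle (replace c j v).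
Proof.
move=> cE /andP[v1 v2] i; rewrite /replace.
case: eqP => [->|_].
  by rewrite -subr_eq0 addrAC subrr add0r (negbTE (oner_neq0 _)).
case: eqP => [ij|//]; move: v1; rewrite -ij addrK eS //.
Qed.

Lemma twin_cycle c j : edge_cycle c -> twin c j (c j).
Proof. by move=> cE; rewrite /twin cE andbT eS -{2}(subrK 1%R j) cE. Qed.

End ShortestOddCycle.

End Walks.

(** * The odd cycle with a pendant vertex *)

Section PendantRank.

Variable m : nat.
Hypothesis m_odd : odd m.+3.
Local Notation n := m.+3.

(* On the cycle plus a pendant vertex [None] attached at [0], the two ranks
   [pendant_rank false] and [pendant_rank true] induce opposite orientations of
   every cycle edge and the same orientation of the pendant edge. *)
Definition pendant_rank (t : bool) (x : option 'I_n) : nat :=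
  if x is Some a then if a == 0%R then 1 else if odd a (+) t then 2 else 0 else 0.

Definition pendant_edge (x y : option 'I_n) : bool :=
  match x, y with
  | Some a, Some b => (b == a + 1)%R || (a == b + 1)%R
  | Some a, None | None, Some a => a == 0%R
  | None, None => false
  end.

Lemma ordD1_eq0 (a : 'I_n) : (a + 1 == 0)%R = (a == m.+2 :> nat).
Proof. by rewrite -[LHS]/((a + 1)%R == 0 :> nat) val_ordD1; case: ifP. Qed.

(** Ranks 0 and 2 alternate along the nonzero indices, and index 0 has the middle rank 1. The last
    index is even, so the edges on both sides of 0 follow the same parity rule. *)
Lemma pendant_rank_lt t a :
  (pendant_rank t (Some a) < pendant_rank t (Some (a + 1)%R)) = (odd a == t).
Proof.
rewrite /pendant_rank ordD1_eq0 val_ordD1 -[a == 0%R]/(a == 0 :> nat).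
have om : odd m = false by move: m_odd => /=; rewrite negbK => /negbTE.
have [->|am] := eqVneq (a : nat) m.+2; first by rewrite /= om; case: t.
have [->|a0] := eqVneq (a : nat) 0; first by case: t.
by rewrite /=; case: (odd a); case: t.
Qed.

Lemma pendant_rank_gt t a :
  (pendant_rank t (Some (a + 1)%R) < pendant_rank t (Some a)) = (odd a != t).
Proof.
rewrite /pendant_rank ordD1_eq0 val_ordD1 -[a == 0%R]/(a == 0 :> nat).
have om : odd m = false by move: m_odd => /=; rewrite negbK => /negbTE.
have [->|am] := eqVneq (a : nat) m.+2; first by rewrite /= om; case: t.
have [->|a0] := eqVneq (a : nat) 0; first by case: t.
by rewrite /=; case: (odd a); case: t.
Qed.

(** A cycle vertex other than 0 is a local maximum or minimum, of in-degree 2 or 0. Vertex 0 lies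
    above [None] and one of its cycle neighbors, and nothing lies below [None]. *)
Lemma pendant_rank_even (t : bool) : even_rank pendant_edge (pendant_rank t).
Proof.
have neq a : (a - 1 != a + 1 :> 'I_n)%R.
  rewrite -subr_eq0 opprD addrACA subrr add0r -opprD oppr_eq0.
  exact: two_neq0.
have step a : pendant_rank t (Some a) != pendant_rank t (Some (a + 1)%R).
  by rewrite neq_ltn pendant_rank_lt pendant_rank_gt; case: eqP.
split=> [[a|] [b|]|[b|]] //.
- by case/orP => /eqP ->; rewrite // eq_sym.
- by move=> /eqP ->.
- by move=> /eqP ->.
- have lower a : pendant_edge (Some a) (Some b) &&
      (pendant_rank t (Some a) < pendant_rank t (Some b)) =
      (a == b - 1)%R && (odd (b - 1)%R == t) || (a == b + 1)%R && (odd b != t).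
    have -> : pendant_edge (Some a) (Some b) = (a == b - 1)%R || (a == b + 1)%R.
      by rewrite /pendant_edge [(a == b - 1)%R]eq_sym subr_eq.
    have [->|_] := eqVneq a (b - 1)%R.
      have := pendant_rank_lt t (b - 1)%R; rewrite subrK => ->.
      by rewrite (negbTE (neq b)) /= orbF.
    by have [->|_] := eqVneq a (b + 1)%R; rewrite //= pendant_rank_gt.
  have [b0|b0] := eqVneq b 0%R.
    rewrite [[set _ | _]](_ : _ = [set None; Some (if t then b + 1 else b - 1)%R]).
      by rewrite cards2.
    have ob : odd (b - 1)%R = false.
      have : (b - 1 + 1 == 0)%R by rewrite subrK b0.
      by rewrite ordD1_eq0 => /eqP ->; move: m_odd => /=; rewrite negbK => /negbTE ->.
    apply/setP => -[a|]; rewrite !inE; last by rewrite b0.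
    by rewrite lower ob b0 /=; case: (boolP t) => _; rewrite ?andbT ?andbF ?orbF.
  have ob : odd (b - 1)%R = ~~ odd b.
    rewrite -{2}(subrK 1%R b) val_ordD1 -ordD1_eq0 subrK (negbTE b0) /= negbK //.
  have [obt|obt] := eqVneq (odd b) t.
    rewrite eq_card0 // => -[a|]; rewrite !inE ?lower ?ob ?obt ?eqxx //= ?(negbTE b0) //.
    by case: (boolP t) => _; rewrite ?andbF.
  rewrite [[set _ | _]](_ : _ = [set Some (b - 1)%R; Some (b + 1)%R]).
    by rewrite cards2 (inj_eq Some_inj) neq.
  apply/setP => -[a|]; rewrite !inE ?lower ?ob //= ?(negbTE b0) //.
  by move: obt; case: (boolP t) => _; case: (odd b) => //=; rewrite !andbT.
- rewrite eq_card0 // => -[a|]; rewrite !inE //=.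
  by case: eqP => // ->.
Qed.

Lemma odd_pendant_disagreements :
  odd #|[set a | [&& pendant_edge a.1 a.2,
     pendant_rank false a.1 < pendant_rank false a.2
   & pendant_rank true a.2 < pendant_rank true a.1]]|.
Proof.
(* [f a] is the cycle edge between [a] and [a + 1], directed upwards for [pendant_rank false]; the
   disagreements are these [n] pairs. *)
pose f (a : 'I_n) : option 'I_n * option 'I_n :=
  if odd a then (Some (a + 1)%R, Some a) else (Some a, Some (a + 1)%R).
have fI : injective f.
  move=> a b; rewrite /f; case: (odd a); case: (odd b) => -[] // ab ba.
    by have := two_neq0 m; rewrite -(inj_eq (addrI a)) addr0 mulr2n addrA ab ba eqxx.
  by have := two_neq0 m; rewrite -(inj_eq (addrI b)) addr0 mulr2n addrA -ab -ba eqxx.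
rewrite [[set _ | _]](_ : _ = f @: setT) ?card_imset // ?cardsT ?card_ord //.
apply/setP => -[x y]; rewrite inE /=; apply/idP/imsetP => [|[a _]].
  case: x y => [a|] [b|] //=.
  - case/andP => /orP[/eqP ->|/eqP ->].
    + rewrite pendant_rank_lt pendant_rank_gt => oa; exists a => //.
      by rewrite /f; case: (odd a) oa.
    + rewrite pendant_rank_lt pendant_rank_gt => ob; exists b => //.
      by rewrite /f; case: (odd b) ob.
  - by case: eqP => // ->.
  - by case: eqP => // ->.
by rewrite /f; case: ifP => oa [-> ->] /=;
  rewrite eqxx ?orbT pendant_rank_lt pendant_rank_gt oa.
Qed.

End PendantRank.

(** * Every vertex is a twin of a cycle vertex *)

Section Structure.

Variables (T : finType) (e : rel T).
Hypotheses (eS : symmetric e) (eI : irreflexive e) (e_conn : connected_graph e).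
Hypothesis nu_eta : forall A : {set T}, nu (induced e A) = eta (induced e A).
Variable m : nat.
Hypothesis girth : odd_girth e m.+3.
Local Notation n := m.+3.
Implicit Types (c : 'I_n -> T) (i j : 'I_n).

Lemma no_pendant_vertex c i v : edge_cycle e c -> ~ (forall j, e v (c j) = (j == i)).
Proof.
(* Rotate the cycle so that [v] is attached at index 0. *)
move=> cE vc; pose c' j := c (i + j)%R.
have cE' : edge_cycle e c' by move=> j; rewrite /c' addrA; apply: cE.
have vc' j : e v (c' j) = (j == 0)%R.
  by rewrite /c' vc -{2}[i]addr0 (inj_eq (addrI i)).
pose f (x : option 'I_n) := if x is Some a then c' a else v.
(* A cycle vertex has two distinct neighbors on the cycle, whereas [v] has one. *)
have vNc a : c' a != v.
  apply/eqP => av; have := vc' (a + 1)%R; have := vc' (a - 1)%R.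
  rewrite -av cE' eS -{2}(subrK 1%R a) cE' => /esym /eqP a1 /esym /eqP.
  by apply/eqP; rewrite -(subrK 1%R a) a1 add0r; apply: (two_neq0 m).
have fI : injective f.
  move=> [a|] [b|] //= => [/(cycle_inj eS girth cE') -> //|/eqP|/esym/eqP].
    by rewrite (negbTE (vNc a)).
  by rewrite (negbTE (vNc b)).
have fE : relpre f e =2 @pendant_edge m.
  move=> [a|] [b|] /=; first exact: (cycle_adj eS girth).
  - by rewrite eS.
  - by [].
  - exact: eI.
have rank t : even_rank (relpre f e) (@pendant_rank m t).
  have [gP gE] := pendant_rank_even girth.1 t.
  split=> [x y|y]; first by rewrite fE; apply: gP.
  have := gE y; congr (~~ odd _); apply: eq_card => x; by rewrite !inE fE.
have := embedded_even_rank_disagreements eS eI nu_eta fI (rank false) (rank true).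
apply/negP; rewrite negbK; have := odd_pendant_disagreements girth.1.
by congr (odd _); apply: eq_card => -[x y]; rewrite !inE -fE.
Qed.

Lemma neighbor_twin c i v : edge_cycle e c -> e v (c i) ->
  twin e c (i + 1)%R v \/ twin e c (i - 1)%R v.
Proof.
move=> cE vi; rewrite /twin addrK subrK vi /= andbT -addrA -addrA.
rewrite -[(1 + 1)%R]/(2%:R)%R -opprD -[(1 + 1)%R]/(2%:R)%R.
apply/orP/negPn/negP; rewrite negb_or => /andP[/negP v1 /negP v2].
apply: (@no_pendant_vertex c i v cE) => j; apply/idP/eqP => [vj|-> //].
by case: (common_neighbor eS girth cE vi vj) => // ji; rewrite ji in vj.
Qed.

Lemma replace_id c j v : replace c j v j = v.
Proof. by rewrite /replace eqxx. Qed.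

Lemma replace_neq c i j v : i != j -> replace c j v i = c i.
Proof. by rewrite /replace => /negbTE ->. Qed.

Lemma addr_neq i (x : 'I_n) : x != 0%R -> (i + x != i)%R.
Proof. by move=> x0; rewrite -subr_eq0 addrC addKr. Qed.

Lemma subr_neq i (x : 'I_n) : x != 0%R -> (i - x != i)%R.
Proof. by move=> x0; rewrite addr_neq // oppr_eq0. Qed.

(** Induction along a path from [c 0]: being a twin passes from [u] to its neighbor [w]. *)
Lemma all_twins c v : edge_cycle e c -> exists j, twin e c j v.
Proof.
move=> cE; have /connectP[p cp ->] := e_conn (c 0%R) v.
have : exists j, twin e c j (c 0%R) by exists 0%R; apply: twin_cycle.
elim: p (c 0%R) cp => //= w p IHp u /andP[euw wp] [j uj]; apply: (IHp w wp).
have wj : e w (replace c j u j) by rewrite replace_id eS.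
have two0 := two_neq0 m.
(* In the cycle with [u] at position [j], the vertex [w] is a twin for [j + 1] or [j - 1], so it
   sees position [j + 2] or [j - 2], which still carries a vertex of [c]. *)
have near : exists i, e w (c i).
  have [/andP[_]|/andP[+ _]] := neighbor_twin (replace_cycle eS cE uj) wj.
    rewrite -addrA -[(1 + 1)%R]/(2%:R)%R replace_neq; first by exists (j + 2%:R)%R.
    by rewrite addr_neq.
  rewrite -addrA -opprD -[(1 + 1)%R]/(2%:R)%R replace_neq; first by exists (j - 2%:R)%R.
  by rewrite subr_neq.
have [i wi] := near.
by case: (neighbor_twin cE wi) => ?; eexists; eassumption.
Qed.

End Structure.

(** Non-adjacency is an equivalence relation here, and its classes [cls] are the parts. *)
Lemma complete_multipartite_of_cotransitive (T : finType) (e : rel T) :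
  symmetric e -> irreflexive e -> (forall x y z, e x z -> e x y || e y z) ->
  complete_multipartite e.
Proof.
move=> eS eI eT; pose cls x := [set y | ~~ e x y].
have clsE x y : y \in cls x -> cls y = cls x.
  rewrite inE => nxy; apply/setP => z; rewrite !inE; congr (~~ _).
  apply/idP/idP => [/(eT y x)|/(eT x y)]; last by rewrite (negbTE nxy).
  by rewrite eS (negbTE nxy).
have clsx x : x \in cls x by rewrite inE eI.
pose P := [set cls x | x : T].
have Pcls x : cls x \in P by apply: imset_f.
pose V (i : 'I_#|P|) : {set T} := enum_val i.
pose idx x : 'I_#|P| := enum_rank_in (Pcls x) (cls x).
have Vidx x : V (idx x) = cls x by rewrite /V enum_rankK_in.
have VP x i : x \in V i -> i = idx x.
  move=> xi; apply: enum_val_inj; rewrite -/(V i) -/(V (idx x)) Vidx.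
  have /imsetP[y _ Vi] : V i \in P by apply: enum_valP.
  by move: xi; rewrite Vi => /clsE ->.
exists #|P|, V; split; first split.
- move=> i; have /imsetP[y _ Vi] : V i \in P by apply: enum_valP.
  by apply/set0Pn; exists y; rewrite Vi.
- by move=> x; exists (idx x); split=> [|i /VP ->] //; rewrite Vidx.
move=> u v; split=> [euv|[i [j [ij /VP ui /VP vj]]]].
  exists (idx u), (idx v); rewrite !Vidx; split=> //.
  apply: contraTneq euv => uv; have := clsx v.
  by rewrite -Vidx -uv Vidx inE.
apply: contraNT ij => nuv; rewrite ui vj.
by apply/eqP/VP; rewrite Vidx inE.
Qed.

(** * Triangles and longer odd cycles *)

Section Classification.

Variables (T : finType) (e : rel T).
Hypotheses (eS : symmetric e) (eI : irreflexive e) (e_conn : connected_graph e).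
Hypothesis nu_eta : forall A : {set T}, nu (induced e A) = eta (induced e A).

Lemma triangle_complete_multipartite (c : 'I_3 -> T) :
  odd_girth e 3 -> edge_cycle e c -> complete_multipartite e.
Proof.
move=> girth cE; apply: complete_multipartite_of_cotransitive => // x y z xz.
(* Two replacements produce a triangle [d] through both [x] and [z]. Then [y] is a twin of some
   [d k], hence adjacent to the other two vertices, and one of these is [x] or [z]. *)
have [d [dE [i [j [ij di dj]]]]] :
    exists d : 'I_3 -> T, edge_cycle e d /\ exists i j, [/\ i != j, d i = x & d j = z].
  have [i xi] := all_twins eS eI e_conn nu_eta girth x cE.
  have cE1 := replace_cycle eS cE xi.
  have zi : e z (replace c i x i) by rewrite replace_id eS.
  have [zj|zj] := neighbor_twin eS eI nu_eta girth cE1 zi.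
    exists (replace (replace c i x) (i + 1)%R z); split; first exact: replace_cycle.
    have ij : (i != i + 1)%R by rewrite eq_sym addr_neq ?oner_eq0.
    by exists i, (i + 1)%R; rewrite replace_id replace_neq // replace_id.
  exists (replace (replace c i x) (i - 1)%R z); split; first exact: replace_cycle.
  have ij : (i != i - 1)%R by rewrite eq_sym subr_neq ?oner_eq0.
  by exists i, (i - 1)%R; rewrite replace_id replace_neq // replace_id.
have [k /andP[y1 y2]] := all_twins eS eI e_conn nu_eta girth y dE.
have near (l : 'I_3) : l != k -> e y (d l).
  move=> lk; suff [->|->] : l = (k - 1)%R \/ l = (k + 1)%R by [].
  by case: l k lk {y1 y2} => [[|[|[|//]]] hl] [[|[|[|//]]] hk] //= _;
     (by left; apply/val_inj) || (by right; apply/val_inj).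
have [ik|/near] := eqVneq i k; last by rewrite di eS => ->.
by rewrite -dj near ?orbT // -ik eq_sym.
Qed.

Section Blowup.

Variables (m : nat) (c : 'I_m.+3 -> T).
Hypotheses (girth : odd_girth e m.+3) (n_gt3 : 3 < m.+3) (cE : edge_cycle e c).
Local Notation n := m.+3.

(** Here length 3 is excluded: 6 vanishes modulo 3, but modulo no odd number above 3. *)
Lemma small_neq0 : [/\ 2%:R != 0 :> 'I_n, 4%:R != 0 :> 'I_n & 6%:R != 0 :> 'I_n]%R.
Proof.
have on := girth.1; rewrite !natr_eq0_ord; split; first by rewrite gtnNdvd.
  by rewrite gtnNdvd //; lia.
apply/negP => n6; have := dvdn_leq (isT : 0 < 6) n6 => n_le6.
have n5 : n = 5 by lia.
by rewrite n5 in n6.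
Qed.

(** [v] would see positions [i - 1] and [i + 3], whose difference 4 would have to be 0, 2 or -2. *)
Lemma twin_add2 i v : twin e c i v -> twin e c (i + 2%:R)%R v -> False.
Proof.
case/andP=> vi _ /andP[_ vj]; have [n2 n4 n6] := small_neq0.
case: (common_neighbor eS girth cE vi vj) => h.
- case/eqP: n4; have -> : (4%:R = (i + 2%:R + 1) - (i - 1) :> 'I_n)%R by ring.
  by rewrite h subrr.
- case/eqP: n2; have -> : (2%:R = (i + 2%:R + 1) - (i - 1 + 2%:R) :> 'I_n)%R by ring.
  by rewrite h subrr.
- case/eqP: n6; have -> : (6%:R = (i + 2%:R + 1) - (i - 1 - 2%:R) :> 'I_n)%R by ring.
  by rewrite h subrr.
Qed.

Lemma twin_unique i j v : twin e c i v -> twin e c j v -> i = j.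
Proof.
move=> vi vj; have [/andP[_ v1] /andP[_ v2]] := (vi, vj).
case: (common_neighbor eS girth cE v1 v2) => [/addIr //| h | h].
  case: (twin_add2 vi); suff -> : (i + 2%:R = j)%R by [].
  by apply: (addIr 1%R); rewrite h; ring.
case: (twin_add2 vj); suff -> : (j + 2%:R = i)%R by [].
by apply: (addIr 1%R); rewrite addrAC h; ring.
Qed.

(** With [u] placed at position [i], the vertex [v] sees [i], [j - 1] and [j + 1], so both of the
    latter lie in [i], [i + 2], [i - 2]. The one combination outside the conclusion is
    [j - 1 = i + 2] with [j + 1 = i - 2], which gives 6 = 0. *)
Lemma twin_adj i j u v : twin e c i u -> twin e c j v -> e u v ->
  (j = i + 1)%R \/ (i = j + 1)%R.
Proof.
move=> ui /andP[v1 v2] euv; have cE' := replace_cycle eS cE ui.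
have vi : e v (replace c i u i) by rewrite replace_id eS.
have [<-|ij1] := eqVneq (j + 1)%R i; first by right.
have [<-|ij2] := eqVneq (j - 1)%R i; first by left; rewrite subrK.
rewrite -(replace_neq c u ij1) in v2; rewrite -(replace_neq c u ij2) in v1.
have [h|h|h2] := common_neighbor eS girth cE' vi v2; first by rewrite h eqxx in ij1.
  by left; apply: (addIr 1%R); rewrite h; ring.
have [h|h1|h] := common_neighbor eS girth cE' vi v1; first by rewrite h eqxx in ij2.
  have [_ _ /eqP[]] := small_neq0.
  have -> : (6%:R = (i + 2%:R) - (i - 2%:R) + 2%:R :> 'I_n)%R by ring.
  by rewrite -h1 -h2; ring.
right; apply: (addIr (- 2%:R)%R); rewrite -h; ring.
Qed.

(** With [u] placed at [i], the vertex [v] sees position [i + 2], so it is a twin for [i + 1] or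
    [i + 3]. The second case would make it see [c i] and [c (i + 4)]; the first makes it adjacent to
    [u]. *)
Lemma twin_succ_adj i u v : twin e c i u -> twin e c (i + 1)%R v -> e u v.
Proof.
move=> ui; rewrite /twin addrK => /andP[v1 v2]; have cE' := replace_cycle eS cE ui.
have [n2 n4 n6] := small_neq0.
rewrite -addrA -[(1 + 1)%R]/(2%:R)%R in v2.
rewrite -(replace_neq c u (addr_neq i n2)) in v2.
have [/andP[_]|/andP[+ _]] := neighbor_twin eS eI nu_eta girth cE' v2.
  have -> : (i + 2%:R + 1 + 1 = i + 4%:R)%R by ring.
  rewrite replace_neq ?addr_neq // => v3.
  have [/eqP|/addrI h|/addrI h] := common_neighbor eS girth cE v1 v3.
  - by rewrite (negbTE (addr_neq i n4)).
  - by case/eqP: n2; have -> : (2%:R = 4%:R - 2%:R :> 'I_n)%R by [ring]; rewrite h subrr.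
  - by case/eqP: n6; have -> : (6%:R = 4%:R - - 2%:R :> 'I_n)%R by [ring]; rewrite h subrr.
by have -> : (i + 2%:R - 1 - 1 = i)%R by [ring]; rewrite replace_id eS.
Qed.

Lemma ordSE (i : 'I_n) : ordS i = (i + 1)%R.
Proof. by apply/val_inj; rewrite /= addn1. Qed.

Lemma odd_cycle_blowup : cycle_blowup e.
Proof.
exists n, (fun i => [set v | twin e c i v]); split=> //.
  split=> [i|u].
    by apply/set0Pn; exists (c i); rewrite inE twin_cycle.
  have [j uj] := all_twins eS eI e_conn nu_eta girth u cE.
  exists j; split=> [|i]; rewrite inE // => ui.
  exact: twin_unique uj ui.
move=> u v; split=> [euv|[i]]; last first.
  rewrite !inE ordSE => -[[ui vi]|[vi ui]]; first exact: twin_succ_adj ui vi.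
  by rewrite eS; apply: twin_succ_adj vi ui.
have [i ui] := all_twins eS eI e_conn nu_eta girth u cE.
have [j vj] := all_twins eS eI e_conn nu_eta girth v cE.
have [h|h] := twin_adj ui vj euv; [exists i; left | exists j; right];
  by rewrite !inE ordSE -h.
Qed.

End Blowup.

End Classification.

Theorem theorem1p5 (T : finType) (e : rel T) (e_sym : symmetric e)
    (e_irr : irreflexive e) (e_conn : connected_graph e)
    (nu_eta : forall A : {set T}, nu (induced e A) = eta (induced e A)) :
  bipartite e \/ complete_multipartite e \/ cycle_blowup e.
Proof.
have [bip|[k kP]] := bipartite_or_odd_walk e_sym e_conn; first by left.
right; have [[|m] [c [girth cE]]] := shortest_odd_cycle e_irr kP.
  by left; apply: triangle_complete_multipartite girth cE.
by right; apply: (odd_cycle_blowup e_sym e_irr e_conn nu_eta girth).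
Qed.
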